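(* Let $G$ be a finite, simple, undirected, connected graph of chromatic number $k$. If $G$ contains a cycle of length $k$, then $G$ has a $k$-coloring $f$ such that, for every vertex $u$ of $G$, some full $f$-rainbow path begins at $u$.
   Context: For a positive integer $k$, $[k]=\{1,\dots,k\}$. A $k$-coloring of $G$ is a function $f:V(G)\to[k]$ with $f(u)\neq f(v)$ for every two adjacent vertices $u,v$; the chromatic number is the minimum $k$ for which a $k$-coloring exists. For a $k$-coloring $f$, an $f$-rainbow path is a path in $G$ whose vertices have pairwise distinct colors under $f$; it is full if it has order (number of vertices) $k$. A path begins at $u$ if $u$ is one of its end vertices. *)

(* Defs.v *)
From mathcomp Require Import all_boot.
Set Implicit Arguments. Unset Strict Implicit. Unset Printing Implicit Defensive.

Definition simple_graph (T : finType) (e : rel T) : Prop :=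
  symmetric e /\ irreflexive e.

Definition connected_graph (T : finType) (e : rel T) : Prop :=
  forall x y : T, connect e x y.

Definition proper_coloring (T : finType) (e : rel T) (k : nat) (f : T -> 'I_k) : Prop :=
  forall u v : T, e u v -> f u != f v.

Definition colorable (T : finType) (e : rel T) (k : nat) : Prop :=
  exists f : T -> 'I_k, proper_coloring e f.

Definition chromatic_number (T : finType) (e : rel T) (k : nat) : Prop :=
  colorable e k /\ forall j, j < k -> ~ colorable e j.

Definition is_gpath (T : finType) (e : rel T) (p : seq T) : Prop :=
  match p with
  | [::] => False
  | x :: q => path e x q && uniq p
  end.

Definition has_cycle_of_length (T : finType) (e : rel T) (n : nat) : Prop :=
  exists c : seq T, [/\ 3 <= n, size c = n, uniq c & cycle e c].

Definition rainbow (T : finType) (k : nat) (f : T -> 'I_k) (p : seq T) : Prop :=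
  uniq (map f p).

(* full f-rainbow path beginning at u (u an end vertex; by reversal we may
   take u to be the first vertex). *)
Definition full_rainbow_path_from (T : finType) (e : rel T) (k : nat)
  (f : T -> 'I_k) (u : T) : Prop :=
  exists p : seq T, [/\ is_gpath e p, rainbow f p, size p = k &
                        (head u p == u) || (last u p == u)].

(* Main.v *)
Require Import Defs.
From mathcomp Require Import all_boot fingroup perm zify.
Set Implicit Arguments. Unset Strict Implicit. Unset Printing Implicit Defensive.

(** Fix a proper k-coloring f and let D be the digraph with an arc u -> v for
    every edge uv with f(v) = f(u) + 1 (mod k). Adding 1 to the colors of a
    D-closed set of vertices keeps f proper, and a D-walk on k vertices is a
    full rainbow path.

    If D has a directed cycle, repeatedly shifting the set of vertices that do
    not reach this cycle makes every vertex reach it, since G is connected;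
    then D-walks of every length start everywhere.

    To get a directed cycle, let c_0, ..., c_(k-1) be the given cycle and
    normalize f so that c_0, ..., c_(t-1) have colors 0, ..., t-1. If t = k the
    given cycle is directed. Otherwise let c_t have color s < t. If D is
    acyclic, then shifting the D-closure of c_t (when it avoids c_s) or of c_s
    (when it avoids c_t) either makes c_0, ..., c_t rainbow, or gives c_t the
    color of c_(s+1). So (t, s) increases lexicographically. *)

Definition next_color_arc (T : finType) (e : rel T) (k : nat) (f : T -> 'I_k) : rel T :=
  [rel u v | e u v && (f v == ordS (f u))].

Definition shift_on (T : finType) (k : nat) (S : pred T) (f : T -> 'I_k) : T -> 'I_k :=
  fun u => if S u then ordS (f u) else f u.

(** An arc with a walk back from its head to its tail: a directed cycle described by reachability
    alone. *)
Definition has_dicycle (T : finType) (e : rel T) (k : nat) (f : T -> 'I_k) : Prop :=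
  exists x y, next_color_arc e f x y /\ connect (next_color_arc e f) y x.

(** * Cyclic successor on the colors *)

Section OrdS.

Variable k : nat.

Lemma val_iter_ordS n (i : 'I_k) : val (iter n (@ordS k) i) = (i + n) %% k.
Proof.
elim: n => [|n IHn] /=; first by rewrite addn0 modn_small.
by rewrite IHn -[X in X %% k]addn1 modnDml addn1 addnS.
Qed.

Lemma ex_iter_ordS (i j : 'I_k) : exists n, j = iter n (@ordS k) i.
Proof.
(* This represents [j - i] modulo [k] without truncated subtraction. *)
exists (j + (k - i)); apply: val_inj; rewrite val_iter_ordS.
have ik := ltn_ord i; have jk := ltn_ord j.
have -> : i + (j + (k - i)) = j + k by lia.
by rewrite modnDr modn_small.
Qed.

Lemma uniq_traject_ordS (i : 'I_k) : uniq (traject (@ordS k) i k).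
Proof.
apply/(uniqP i) => a b; rewrite !inE size_traject => ak bk.
rewrite !nth_traject // => /(congr1 val); rewrite !val_iter_ordS => /eqP.
by rewrite eqn_modDl !modn_small // => /eqP.
Qed.

End OrdS.

Lemma connect_first (T : finType) (r : rel T) x y :
  connect r x y -> x != y -> exists2 z, r x z & connect r z y.
Proof.
case/connectP=> [[|z p]] /= => [_ ->|]; first by rewrite eqxx.
case/andP=> rxz pz -> _; exists z => //; by apply/connectP; exists p.
Qed.

(** * Shifting colors on closed sets; rainbow paths from walks *)

Section Shift.

Variables (T : finType) (e : rel T) (k : nat).
Hypothesis e_sym : symmetric e.
Implicit Types f : T -> 'I_k.

(** Adjacent vertices on the same side of [S] keep distinct colors. Across the boundary, a clash
    would need an arc leaving [S]. *)
Lemma proper_shift_on f (S : pred T) :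
  proper_coloring e f ->
  (forall u v, S u -> next_color_arc e f u v -> S v) ->
  proper_coloring e (shift_on S f).
Proof.
move=> fP Scl.
have out u v : e u v -> S u -> ~~ S v -> ordS (f u) != f v.
  move=> euv Su; apply: contra => /eqP fE.
  by apply: (Scl u) => //; rewrite /next_color_arc /= euv fE eqxx.
move=> u v euv; rewrite /shift_on; case: ifPn => Su; case: ifPn => Sv.
- by rewrite (inj_eq (@ordS_inj k)); apply: fP.
- exact: out.
- by rewrite eq_sym; apply: out; rewrite // e_sym.
- exact: fP.
Qed.

Lemma proper_shift_on_connect f w :
  proper_coloring e f ->
  proper_coloring e (shift_on (connect (next_color_arc e f) w) f).
Proof.
move=> fP; apply: proper_shift_on => // u v wu uv.
exact: connect_trans wu (connect1 uv).
Qed.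

Lemma map_color_path f u p :
  path (next_color_arc e f) u p -> map f (u :: p) = traject (@ordS k) (f u) (size p).+1.
Proof.
elim: p u => //= v p IHp u /andP[/andP[_ /eqP fv] vp].
by rewrite -fv -IHp.
Qed.

(** The colors along the walk are [k] cyclically consecutive ones, hence distinct, and so the
    vertices are distinct too. *)
Lemma full_rainbow_of_path f u p :
  path (next_color_arc e f) u p -> (size p).+1 = k ->
  full_rainbow_path_from e f u.
Proof.
move=> up szp; have upU : uniq (map f (u :: p)).
  by rewrite (map_color_path up) szp uniq_traject_ordS.
exists (u :: p); split=> //=; last by rewrite eqxx.
rewrite -/(uniq (u :: p)) (map_uniq upU) andbT.
by apply: sub_path up => a b /andP[].
Qed.

Lemma long_path_of_invariant (r : rel T) (A : pred T) :
  (forall u, A u -> exists2 v, r u v & A v) ->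
  forall n u, A u -> exists2 p, path r u p & size p = n.
Proof.
move=> Astep; elim=> [|n IHn] u Au; first by exists [::].
have [v uv /IHn[p vp szp]] := Astep u Au.
by exists (v :: p) => /=; rewrite ?uv ?szp.
Qed.

Lemma full_rainbow_of_dicycle f x y u : 0 < k ->
  next_color_arc e f x y -> connect (next_color_arc e f) y x ->
  connect (next_color_arc e f) u x -> full_rainbow_path_from e f u.
Proof.
move=> k_gt0 xy yx ux.
(* A vertex reaching [x] has a successor reaching [x]: the next one on a walk to [x], or [y] if it
   is [x] itself. *)
have [v vx|p up szp] := @long_path_of_invariant (next_color_arc e f)
    (fun v => connect (next_color_arc e f) v x) _ k.-1 u ux.
  by have [->|/(connect_first vx)//] := eqVneq v x; exists y.
by apply: full_rainbow_of_path up _; rewrite szp prednK.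
Qed.

End Shift.

(** * Making every vertex reach the directed cycle *)

Section Attract.

Variables (T : finType) (e : rel T) (k : nat).
Hypotheses (e_sym : symmetric e) (e_conn : connected_graph e).
Implicit Types f : T -> 'I_k.

Let reach f x : pred T := fun u => connect (next_color_arc e f) u x.
Let dicyclic_at f x y := [/\ proper_coloring e f, next_color_arc e f x y & reach f x y].

Lemma edge_leaving (A : pred T) x u :
  A x -> ~~ A u -> exists a b, [/\ e a b, ~~ A a & A b].
Proof.
move=> Ax Au; have /connectP[p up xE] := e_conn u x.
move: Ax; rewrite xE; elim: p u Au up {xE} => [|v p IHp] u Au /=.
  by rewrite (negPf Au).
case/andP=> uv vp; case: (boolP (A v)) => [Av _|Av]; first by exists u, v.
exact: IHp.
Qed.

(** No arc goes from a non-reaching vertex to a reaching one, so the shifted set is closed. Reaching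
    vertices keep their colors, hence their walks to [x]. *)
Lemma shift_unreaching f x y (g := shift_on (fun u => ~~ reach f x u) f) :
  dicyclic_at f x y -> dicyclic_at g x y /\ forall u, reach f x u -> reach g x u.
Proof.
case=> fP xy yx.
have gE u : reach f x u -> g u = f u by rewrite /g /shift_on => ->.
have sub u v : reach f x v -> next_color_arc e f u v -> next_color_arc e g u v.
  move=> vx uv; have ux : reach f x u := connect_trans (connect1 uv) vx.
  by rewrite /next_color_arc /= !gE.
have reachS u : reach f x u -> reach g x u.
  case/connectP=> p; elim: p u => [|v p IHp] u /=; first by move=> _ ->; exact: connect0.
  case/andP=> uv vp xE; apply: connect_trans (IHp v vp xE).
  by apply/connect1/sub => //; apply/connectP; exists p.
split=> //; split; [|exact: sub|exact: reachS].
apply: proper_shift_on => // u v uN uv; apply: contra uN.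
exact: connect_trans (connect1 uv).
Qed.

(* Each shift of the unreaching set brings the color of [a] one step closer to
   the color preceding that of [b]. *)
Lemma attract_edge n f x y a b :
  dicyclic_at f x y -> e a b -> ~~ reach f x a -> reach f x b ->
  f b = iter n (@ordS k) (f a) ->
  exists2 g, dicyclic_at g x y & #|reach f x| < #|reach g x|.
Proof.
elim: n f => [|n IHn] f fC ab aN bR fb.
  (* Distance 0 would give the adjacent [a] and [b] equal colors, so [a] starts to reach [x] before
     that. *)
  by case: (fC) => fP _ _; have := fP _ _ ab; rewrite fb eqxx.
have [] := shift_unreaching fC; set g := shift_on _ f => gC fg.
case: (boolP (reach g x a)) => [aR|aN'].
  exists g => //; apply: proper_card; apply/properP; split.
    by apply/subsetP=> u; apply: fg.
  by exists a.
have [|h hC lt_gh] := IHn g gC ab aN' (fg _ bR).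
  by rewrite /g /shift_on bR aN /= -iterSr.
exists h => //; apply: leq_ltn_trans lt_gh.
by apply: subset_leq_card; apply/subsetP=> u; apply: fg.
Qed.

(** Induction on the number of non-reaching vertices; connectedness supplies the edge for
    [attract_edge]. *)
Lemma attract_all f x y :
  dicyclic_at f x y -> exists2 g, dicyclic_at g x y & forall u, reach g x u.
Proof.
have [n] := ubnP (#|T| - #|reach f x|); elim: n f => // n IHn f lt_n fC.
case: (boolP [forall u, reach f x u]) => [/forallP|/forallPn[u uN]].
  by exists f.
have [a [b [ab aN bR]]] := @edge_leaving (reach f x) x u (connect0 _ x) uN.
have [m fb] := ex_iter_ordS (f a) (f b).
have [g gC lt_fg] := attract_edge fC ab aN bR fb.
apply: IHn gC; have := max_card (reach g x); lia.
Qed.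

Lemma full_rainbow_of_has_dicycle f : 0 < k ->
  proper_coloring e f -> has_dicycle e f ->
  exists g : T -> 'I_k, proper_coloring e g /\ forall u, full_rainbow_path_from e g u.
Proof.
move=> k_gt0 fP [x [y [xy yx]]].
have [g [gP xy' yx'] gR] := attract_all (And3 fP xy yx).
by exists g; split=> // u; apply: full_rainbow_of_dicycle xy' yx' (gR u).
Qed.

End Attract.

(** * Creating a directed cycle from the given cycle *)

Section Dicycle.

Variables (T : finType) (e : rel T) (n : nat) (c : nat -> T).
Hypothesis e_sym : symmetric e.
Hypothesis c_inj : forall i j, i < j <= n -> c i != c j.
Hypothesis c_path : forall j, j < n -> e (c j) (c j.+1).
Hypothesis c_close : e (c n) (c 0).
Implicit Types f : T -> 'I_n.+1.

Let normalized f t := forall j, j < t -> f (c j) = j :> nat.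
Let rainbow_upto f t := forall i j, i < j < t -> f (c i) != f (c j).

Lemma normalize_rainbow f t : t <= n.+1 -> rainbow_upto f t ->
  exists2 s : 'I_n.+1 -> 'I_n.+1, injective s & normalized (s \o f) t.
Proof.
elim: t => [|t IHt] lt_tn fR; first by exists id.
have [||s s_inj sN] := IHt; first exact: ltnW.
  by move=> i j /andP[ij jt]; apply: fR; rewrite ij ltnW.
(* Neither swapped color occurs among the colors 0, ..., t-1 already placed. *)
exists (tperm (s (f (c t))) (inord t) \o s).
  exact: inj_comp (@perm_inj _ _) s_inj.
move=> j; rewrite ltnS leq_eqVlt => /predU1P[->|jt] /=.
  by rewrite tpermL inordK.
have sj : s (f (c j)) = j :> nat by apply: sN.
rewrite tpermD //.
  by rewrite (inj_eq s_inj) eq_sym; apply: fR; rewrite jt /=.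
by rewrite -val_eqE /= inordK // sj neq_ltn jt orbT.
Qed.

Lemma proper_comp f (s : 'I_n.+1 -> 'I_n.+1) :
  injective s -> proper_coloring e f -> proper_coloring e (s \o f).
Proof. by move=> s_inj fP u v uv; rewrite /= (inj_eq s_inj) fP. Qed.

Lemma connect_normalized f t i j : t <= n.+1 -> normalized f t ->
  i <= j -> j < t -> connect (next_color_arc e f) (c i) (c j).
Proof.
move=> tn fN; elim: j => [|j IHj]; first by rewrite leqn0 => /eqP->.
rewrite leq_eqVlt => /predU1P[->//|ij] jt.
apply: connect_trans (IHj ij (ltnW jt)) (connect1 _).
rewrite /next_color_arc /= c_path ?(leq_trans jt) //=; last by lia.
by rewrite -val_eqE /= !fN ?modn_small //; lia.
Qed.

Lemma has_dicycle_connect f x y : x != y ->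
  connect (next_color_arc e f) x y -> connect (next_color_arc e f) y x ->
  has_dicycle e f.
Proof.
move=> xy /connect_first/(_ xy)[z xz zy] yx.
by exists x, z; split=> //; apply: connect_trans yx.
Qed.

Lemma val_shift_normalized f t (S : pred T) j : t <= n -> normalized f t -> j < t ->
  shift_on S f (c j) = j + S (c j) :> nat.
Proof.
move=> tn fN jt; rewrite /shift_on; case: (S _); last by rewrite addn0 fN.
by rewrite /= fN // addn1 modn_small //; lia.
Qed.

(** Along the prefix, the closure of [w] is a final segment, so the colors remain strictly
    increasing; [t <= n] prevents wrapping to 0. *)
Lemma shift_rainbow_upto f t w
    (g := shift_on (connect (next_color_arc e f) w) f) :
  t <= n -> normalized f t -> rainbow_upto g t.
Proof.
move=> tn fN i j /andP[ij jt]; rewrite -val_eqE /=.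
rewrite !(val_shift_normalized _ tn fN) //; last exact: ltn_trans jt.
have : connect (next_color_arc e f) w (c i) -> connect (next_color_arc e f) w (c j).
  by move/connect_trans; apply; apply: connect_normalized fN _ jt; lia.
case: (connect _ _ (c i)) => [->//|_]; lia.
Qed.

Lemma rainbow_uptoS f t :
  rainbow_upto f t -> (forall j, j < t -> f (c j) != f (c t)) -> rainbow_upto f t.+1.
Proof.
move=> fR ft i j /andP[ij]; rewrite ltnS leq_eqVlt => /predU1P[jt|jt].
  by rewrite jt; apply: ft; rewrite -jt.
by apply: fR; rewrite ij.
Qed.

Lemma normalized_rainbow f t : normalized f t -> rainbow_upto f t.
Proof.
move=> fN i j /andP[ij jt].
by rewrite -val_eqE /= !fN ?neq_ltn ?ij //; apply: ltn_trans jt.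
Qed.

Lemma improve f t : t <= n -> proper_coloring e f -> normalized f t -> f (c t) < t ->
  [\/ has_dicycle e f,
      exists2 g, proper_coloring e g & rainbow_upto g t.+1 |
      exists2 g, proper_coloring e g & [/\ rainbow_upto g t, (f (c t)).+1 < t &
        g (c t) = g (c (f (c t)).+1)]].
Proof.
move=> tn fP fN; set s := nat_of_ord (f (c t)) => st.
have csE : f (c s) = s :> nat by apply: fN.
have cst : c s != c t by apply: c_inj; rewrite st.
have lt_st : s.+1 < t.
  (* If s+1 = t, then [c s] and [c t] would be adjacent with the same color. *)
  rewrite ltn_neqAle st andbT; apply/eqP => tE.
  have := fP (c s) (c t); rewrite -tE c_path => [/(_ isT)|]; last lia.
  by rewrite -val_eqE /= csE tE eqxx.
case: (boolP (connect (next_color_arc e f) (c t) (c s))) => [ts|tNs]; last first.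
  have gP := proper_shift_on_connect e_sym (c t) fP.
  have gR := shift_rainbow_upto (c t) tn fN.
  have gv j jt := val_shift_normalized (connect (next_color_arc e f) (c t)) tn fN jt (j := j).
  move: gP gR gv; set g := shift_on _ f => gP gR gv.
  have gt : g (c t) = s.+1 :> nat.
    by rewrite /g /shift_on connect0 /= modn_small //; lia.
  (* Each such [c j] leads to [c s], which [c t] does not reach. *)
  have low j : j <= s -> connect (next_color_arc e f) (c t) (c j) = false.
    move=> js; apply: contraNF tNs => /connect_trans; apply.
    exact: connect_normalized (leqW tn) fN js st.
  case: (boolP (connect (next_color_arc e f) (c t) (c s.+1))) => [tS|tNS].
    (* Here [c (s+1)], ..., [c (t-1)] all move up, which frees color s+1 for [c t]. *)
    constructor 2; exists g => //; apply: rainbow_uptoS => // j jt.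
    rewrite -val_eqE /= gv // gt; case: (leqP j s) => [js|sj].
      by rewrite low // addn0 neq_ltn ltnS js.
    rewrite (connect_trans tS) ?neq_ltn; first by lia.
    exact: connect_normalized (leqW tn) fN sj jt.
  constructor 3; exists g => //; split=> //.
  by apply: val_inj; rewrite /= gt gv // (negPf tNS) addn0.
case: (boolP (connect (next_color_arc e f) (c s) (c t))) => [st'|sNt].
  by constructor 1; apply: has_dicycle_connect st' ts.
(* Reaching some [c j] with j < s closes a directed cycle along the prefix. *)
case: (boolP [exists j : 'I_s, connect (next_color_arc e f) (c s) (c j)]).
  case/existsP=> j sj; constructor 1; apply: has_dicycle_connect sj _.
    by rewrite eq_sym; apply: c_inj; rewrite ltn_ord; lia.
  exact: connect_normalized (leqW tn) fN (ltnW (ltn_ord j)) st.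
(* Now exactly [c s], ..., [c (t-1)] move up within the prefix, leaving color s to [c t] alone. *)
move/existsPn=> low; constructor 2.
exists (shift_on (connect (next_color_arc e f) (c s)) f).
  exact: proper_shift_on_connect.
apply: rainbow_uptoS; first exact: shift_rainbow_upto.
move=> j jt; rewrite -val_eqE /= (val_shift_normalized _ tn fN) //.
rewrite /shift_on (negPf sNt) -/s; case: (ltnP j s) => [js|sj].
  by rewrite (negPf (low (Ordinal js))) addn0 neq_ltn js.
by rewrite (connect_normalized (leqW tn) fN sj jt) neq_ltn; lia.
Qed.

Lemma has_dicycle_of_rainbow_upto f t : t <= n.+1 ->
  proper_coloring e f -> rainbow_upto f t ->
  exists2 g : T -> 'I_n.+1, proper_coloring e g & has_dicycle e g.
Proof.
have [m] := ubnP (n.+1 - t); elim: m t f => // m IHm t f lt_m tn fP fR.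
have [s s_inj] := normalize_rainbow tn fR; have := proper_comp s_inj fP.
move: (s \o f) => {fP fR s s_inj} {}f fP fN.
move: tn; rewrite leq_eqVlt => /predU1P[tE|]; last rewrite ltnS => tn.
  (* The closing edge is an arc because color n wraps around to 0. *)
  exists f => //; exists (c n), (c 0); split.
    by rewrite /next_color_arc /= c_close -val_eqE /= !fN ?tE // modnn.
  by apply: connect_normalized fN _ _; rewrite // tE.
have done g : proper_coloring e g -> rainbow_upto g t.+1 ->
    exists2 h : T -> 'I_n.+1, proper_coloring e h & has_dicycle e h.
  by move=> gP gR; apply: (IHm t.+1 g) => //; lia.
(* Inner induction for fixed [t]: the color of [c t] climbs until it is at least [t], hence new to
   the prefix. *)
have [d] := ubnP (t - f (c t)); elim: d f fP fN => // d IHd f fP fN lt_d.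
case: (leqP t (f (c t))) => [tf|ft].
  apply: (done f) => //; apply: rainbow_uptoS; first exact: normalized_rainbow.
  by move=> j jt; rewrite -val_eqE /= fN // neq_ltn (leq_trans jt tf).
case: (improve tn fP fN ft) => [fC|[g gP gR]|[g gP [gR lt_s gE]]].
- by exists f.
- exact: done gP gR.
have [s s_inj sN] := normalize_rainbow (leqW tn) gR.
apply: (IHd _ (proper_comp s_inj gP) sN).
(* Renaming preserves the equality of the colors of [c t] and [c (f (c t)).+1], and the latter is
   normalized to its index. *)
by rewrite [X in t - X](_ : _ = (f (c t)).+1 :> nat); [lia | rewrite -(sN _ lt_s) /= gE].
Qed.

Lemma exists_has_dicycle f : proper_coloring e f ->
  exists2 g : T -> 'I_n.+1, proper_coloring e g & has_dicycle e g.
Proof.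
by move=> fP; apply: (@has_dicycle_of_rainbow_upto f 0) => // i j; rewrite andbF.
Qed.

End Dicycle.

Theorem theorem3 (T : finType) (e : rel T) (k : nat) :
  simple_graph e -> connected_graph e -> chromatic_number e k ->
  has_cycle_of_length e k ->
  exists f : T -> 'I_k, proper_coloring e f /\
    forall u : T, full_rainbow_path_from e f u.
Proof.
case=> e_sym _ e_conn [[f fP] _] [[|x p] [k3 szc c_uniq c_cyc]].
  by move: k3; rewrite -szc.
move: szc f fP {k3} => /= <- f fP.
(* With [k] equal to [(size p).+1], only the indices 0, ..., [size p] matter, so the default [x] is
   never reached. *)
pose c j := nth x (x :: p) j.
have [|||g gP gC] := @exists_has_dicycle T e (size p) c e_sym _ _ _ f fP.
- by move=> i j /andP[ij jn]; rewrite nth_uniq ?neq_ltn ?ij //=; lia.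
- by move=> j jp; move: c_cyc; rewrite /= rcons_path => /andP[/(pathP x)/(_ j jp)].
- by move: c_cyc; rewrite /= rcons_path /c (nth_last x (x :: p)) => /andP[].
exact: full_rainbow_of_has_dicycle gC.
Qed.
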